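(* Let $n, r \in \mathbb{N}_0$, let $T$ be an $n$-dimensional simplex with ordered vertices, and let $k \in [0:n]$. Let $\omega_{\alpha\sigma} \in \mathbb{C}$ for $\alpha \in A(r,n)$ and $\sigma \in \Sigma(k,n)$. Then $$\sum_{\alpha \in A(r,n),\ \sigma \in \Sigma(k,n)} \omega_{\alpha\sigma}\, \lambda^{\alpha}\, \mathrm{d}\lambda_{\sigma} = 0 \quad\Longleftrightarrow\quad \sum_{\alpha \in A(r,n),\ \sigma \in \Sigma(k,n)} \epsilon(\sigma,\sigma^c)\, \omega_{\alpha\sigma}\, \lambda^{\alpha} \lambda_{\sigma}\, \phi_{\sigma^c} = 0,$$ and each of these holds if and only if $$\omega_{\alpha\sigma} - \sum_{p \in [\sigma]} \epsilon(p,\sigma-p)\, \omega_{\alpha,\sigma-p+0} = 0$$ for all $\alpha \in A(r,n)$ and all $\sigma \in \Sigma(k,n)$ with $0 \notin [\sigma]$.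
   Context: For integers $a,b$, $[a:b]=\{a,\dots,b\}$ (empty if $a>b$). An $n$-dimensional simplex $T$ is the convex hull of $n+1$ affinely independent points $v_0,\dots,v_n$ (its ordered vertices) in some Euclidean space. The barycentric coordinates $\lambda_0,\dots,\lambda_n$ are the affine functions on $T$ with $\lambda_i(v_j)=\delta_{ij}$, and $\mathrm{d}\lambda_i$ are their exterior derivatives (differential 1-forms on $T$); all differential forms on $T$ have complex-valued coefficients. $A(r,n)$ is the set of maps $\alpha:[0:n]\to\mathbb{N}_0$ with $\sum_{i=0}^n\alpha(i)=r$; $\lambda^\alpha=\prod_{i=0}^n\lambda_i^{\alpha(i)}$. $\Sigma(k,n)$ is the set of strictly increasing maps $[1:k]\to[0:n]$ (with $\Sigma(0,n)=\{\emptyset\}$), and $\Sigma_0(k,n)$ is the set of strictly increasing maps $[0:k]\to[0:n]$; $[\sigma]$ denotes the image of $\sigma$. For $\sigma$ in either set, $\mathrm{d}\lambda_\sigma$ is the wedge product of the $\mathrm{d}\lambda_{\sigma(i)}$ in increasing order of $i$ and $\lambda_\sigma$ is the product of the $\lambda_{\sigma(i)}$ (both equal to $1$ for $\sigma=\emptyset$). For $p\in[\sigma]$, $\sigma-p$ is the strictly increasing map with image $[\sigma]\setminus\{p\}$; for $q\notin[\sigma]$, $\sigma+q$ is the strictly increasing map with image $[\sigma]\cup\{q\}$; so $\sigma-p+0$ has image $([\sigma]\setminus\{p\})\cup\{0\}$. For $\sigma\in\Sigma(k,n)$, $\sigma^c\in\Sigma_0(n-k,n)$ is the strictly increasing map with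 image $[0:n]\setminus[\sigma]$. For $q\notin[\sigma]$, $\epsilon(q,\sigma)$ is the sign of the permutation sorting into ascending order the sequence consisting of $q$ followed by the values of $\sigma$ in order. $\epsilon(\sigma,\sigma^c)$ is the sign of the permutation sorting the values of $\sigma$ (in order) followed by the values of $\sigma^c$ (in order). For $\rho\in\Sigma_0(l,n)$ the Whitney form is $\phi_\rho=\sum_{p\in[\rho]}\epsilon(p,\rho-p)\,\lambda_p\,\mathrm{d}\lambda_{\rho-p}$. *)

(* Defs.v *)
From HB Require Import structures.
From mathcomp Require Import all_boot all_order all_algebra all_fingroup.
From mathcomp Require Import functions reals topology normedtype derive.
From mathcomp Require Import complex.

Set Implicit Arguments.
Unset Strict Implicit.
Unset Printing Implicit Defensive.

Import Order.TTheory GRing.Theory Num.Theory.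
Import numFieldNormedType.Exports.

Local Open Scope ring_scope.
Local Open Scope complex_scope.

Definition edges (R : realType) (m n : nat) (v : 'I_n.+1 -> 'rV[R]_m) :
    n.-tuple 'rV[R]_m :=
  [tuple v (lift ord0 i) - v ord0 | i < n].

Definition affinely_independent (R : realType) (m n : nat)
    (v : 'I_n.+1 -> 'rV[R]_m) : bool :=
  free (edges v).

Definition in_simplex (R : realType) (m n : nat) (v : 'I_n.+1 -> 'rV[R]_m)
    (x : 'rV[R]_m) : Prop :=
  exists t : 'I_n.+1 -> R,
    [/\ forall i, 0 <= t i, \sum_i t i = 1 & x = \sum_i t i *: v i].

Definition tangent_space (R : realType) (m n : nat) (v : 'I_n.+1 -> 'rV[R]_m) :
    {vspace 'rV[R]_m} :=
  <<edges v>>%VS.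

(* When m > n the coordinates are extended from the affine hull of the simplex
   to an affine function on R^m; this extension is arbitrary, but forms are only
   ever evaluated at points of the simplex and on its tangent vectors.
   See bary_affine and bary_vertex for the characteristic properties. *)
Definition bary (R : realType) (m n : nat) (v : 'I_n.+1 -> 'rV[R]_m)
    (i : 'I_n.+1) (x : 'rV[R]_m) : R :=
  if unlift ord0 i is Some j then coord (edges v) j (x - v ord0)
  else 1 - \sum_(j < n) coord (edges v) j (x - v ord0).

Lemma bary_affine (R : realType) (m n : nat) (v : 'I_n.+1 -> 'rV[R]_m)
    (i : 'I_n.+1) (t : R) (x y : 'rV[R]_m) :
  bary v i (t *: x + (1 - t) *: y) = t * bary v i x + (1 - t) * bary v i y.
Proof.
have E : t *: x + (1 - t) *: y - v ord0
         = t *: (x - v ord0) + (1 - t) *: (y - v ord0).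
  by rewrite !scalerBr addrACA -opprD -scalerDl [t + _]addrC subrK scale1r.
rewrite /bary E; case: unlift => [j|]; first by rewrite linearD !linearZ.
under eq_bigr => j _ do rewrite linearD !linearZ /=.
rewrite big_split /= -!mulr_sumr !mulrBr !mulr1 opprD addrACA.
by rewrite [t + _]addrC subrK.
Qed.

Lemma bary_vertex (R : realType) (m n : nat) (v : 'I_n.+1 -> 'rV[R]_m)
    (i j : 'I_n.+1) :
  affinely_independent v -> bary v i (v j) = (i == j)%:R.
Proof.
move=> hv; have coordE (a : 'I_n) (b : 'I_n) :
    coord (edges v) a (v (lift ord0 b) - v ord0) = (a == b)%:R.
  have <- : (edges v)`_b = v (lift ord0 b) - v ord0.
    by rewrite -tnth_nth tnth_mktuple.
  by rewrite coord_free // eq_sym.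
rewrite /bary; case: (unliftP ord0 j) => [b|] ->; case: unliftP => [a|] ->.
- by rewrite coordE (inj_eq (@lift_inj _ _)).
- rewrite (bigD1 b) //= coordE eqxx big1 ?addr0 ?subrr //.
  by move=> a /negPf ab; rewrite coordE ab.
- by rewrite subrr linear0 eq_sym (negPf (neq_lift _ _)).
- by rewrite big1 ?subr0 ?eqxx // => a _; rewrite subrr linear0.
Qed.

(* Alternation and multilinearity are not part of the type: every form used below
   is built from differentials of functions by wedge, fscale and sums. *)
Definition kform (R : realType) (m k : nat) : Type :=
  'rV[R]_m -> ('I_k -> 'rV[R]_m) -> R[i].

HB.instance Definition _ (R : realType) (m k : nat) :=
  GRing.Zmodule.copy (kform R m k) ('rV[R]_m -> ('I_k -> 'rV[R]_m) -> R[i]).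

Definition vanishes_on_simplex (R : realType) (m n k : nat)
    (v : 'I_n.+1 -> 'rV[R]_m) (w : kform R m k) : Prop :=
  forall (x : 'rV[R]_m) (u : 'I_k -> 'rV[R]_m),
    in_simplex v x -> (forall i, u i \in tangent_space v) -> w x u = 0.

Definition fscale (R : realType) (m k : nat) (f : 'rV[R]_m -> R[i])
    (w : kform R m k) : kform R m k :=
  fun x u => f x * w x u.

Definition ext_deriv (R : realType) (m : nat) (f : 'rV[R]_m -> R) :
    kform R m 1 :=
  fun x u => ('D_(u ord0) f x)%:C.

(* With this normalisation (a1 /\ ... /\ ak)(u1, ..., uk) = det (ai(uj)) for
   1-forms ai. *)
Definition wedge (R : realType) (m k l : nat)
    (a : kform R m k) (b : kform R m l) : kform R m (k + l) :=
  fun x u => (k`! * l`!)%:R^-1 *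
    \sum_(s : 'S_(k + l)) (-1) ^+ s *
      (a x (fun i => u (s (lshift l i))) * b x (fun j => u (s (rshift k j)))).

Fixpoint wedges (R : realType) (m k : nat) :
    ('I_k -> kform R m 1) -> kform R m k :=
  match k with
  | 0 => fun _ _ _ => 1
  | k'.+1 => fun a => wedge (a ord0) (wedges (fun i => a (lift ord0 i)))
  end.

(* Multi-indices; values in 'I_r.+1 lose nothing since the sum is r. *)

Definition multi_indices (r n : nat) : {set {ffun 'I_n.+1 -> 'I_r.+1}} :=
  [set a : {ffun 'I_n.+1 -> 'I_r.+1} | (\sum_(i < n.+1) a i)%N == r].

(* Strictly increasing maps. Sigma(k,n) is incr_maps k n, with [1:k] shifted to
   'I_k = [0:k-1], and Sigma_0(l,n) is incr_maps l.+1 n. *)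

Definition increasing (k n : nat) (s : 'I_k -> 'I_n.+1) : bool :=
  [forall i : 'I_k, forall j : 'I_k, (i < j)%N ==> (s i < s j)%N].

Definition incr_maps (k n : nat) : {set {ffun 'I_k -> 'I_n.+1}} :=
  [set s : {ffun 'I_k -> 'I_n.+1} | increasing s].

Definition image_set (k n : nat) (s : {ffun 'I_k -> 'I_n.+1}) :
    {set 'I_n.+1} :=
  [set p | p \in codom s].

(* The strictly increasing map with image A, meaningful when #|A| = k. *)
Definition incr_of_set (k n : nat) (A : {set 'I_n.+1}) :
    {ffun 'I_k -> 'I_n.+1} :=
  [ffun i : 'I_k => nth ord0 (enum A) i].

Lemma incr_of_setP (k n : nat) (A : {set 'I_n.+1}) : #|A| = k ->
  incr_of_set k A \in incr_maps k n /\ image_set (incr_of_set k A) = A.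
Proof.
move=> Ak; have szA : size (enum A) = k by rewrite -cardE.
have srt : sorted (relpre val ltn) (enum A).
  rewrite {1}/enum_mem sorted_filter //; first by move=> a b c; apply: ltn_trans.
  by rewrite -enumT -sorted_map val_enum_ord iota_ltn_sorted.
split; last first.
  apply/setP=> p; rewrite inE; apply/codomP/idP => [[i ->]|pA].
    by rewrite ffunE -mem_enum mem_nth // szA.
  have lt_pk : (index p (enum A) < k)%N by rewrite -szA index_mem mem_enum.
  by exists (Ordinal lt_pk); rewrite ffunE nth_index // mem_enum.
rewrite inE; apply/forallP => i; apply/forallP => j; apply/implyP => ij.
rewrite !ffunE; apply: (sorted_ltn_nth _ ord0 srt) => //.
- by move=> a b c; apply: ltn_trans.
- by rewrite inE szA.
- by rewrite inE szA.
Qed.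

(* remove s p, replace s p q and compl s are sigma - p, sigma - p + q and sigma^c;
   the first two are meaningful for p in the image of s, and replace moreover
   for q outside of it. *)

Definition remove (k n : nat) (s : {ffun 'I_k -> 'I_n.+1}) (p : 'I_n.+1) :
    {ffun 'I_k.-1 -> 'I_n.+1} :=
  incr_of_set k.-1 (image_set s :\ p).

Definition replace (k n : nat) (s : {ffun 'I_k -> 'I_n.+1}) (p q : 'I_n.+1) :
    {ffun 'I_k -> 'I_n.+1} :=
  incr_of_set k (q |: (image_set s :\ p)).

Definition compl (k n : nat) (s : {ffun 'I_k -> 'I_n.+1}) :
    {ffun 'I_(n - k).+1 -> 'I_n.+1} :=
  incr_of_set (n - k).+1 (~: image_set s).

(* The sign of the permutation sorting the values of s followed by those of t;
   the default value 0 only occurs when these values are not distinct. *)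

Definition concat (k l n : nat) (s : {ffun 'I_k -> 'I_n.+1})
    (t : {ffun 'I_l -> 'I_n.+1}) : {ffun 'I_(k + l) -> 'I_n.+1} :=
  [ffun i : 'I_(k + l) => match fintype.split i with inl a => s a | inr b => t b end].

Definition sort_sign (C : pzRingType) (k n : nat)
    (s : {ffun 'I_k -> 'I_n.+1}) : C :=
  if [pick p : 'S_k | increasing (fun i => s (p i))] is Some p
  then (-1) ^+ p else 0.

Definition eps (C : pzRingType) (k l n : nat) (s : {ffun 'I_k -> 'I_n.+1})
    (t : {ffun 'I_l -> 'I_n.+1}) : C :=
  sort_sign C (concat s t).

Definition eps1 (C : pzRingType) (l n : nat) (q : 'I_n.+1)
    (t : {ffun 'I_l -> 'I_n.+1}) : C :=
  eps C [ffun _ : 'I_1 => q] t.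

Definition baryC (R : realType) (m n : nat)
    (v : 'I_n.+1 -> 'rV[R]_m) (i : 'I_n.+1) (x : 'rV[R]_m) : R[i] := (bary v i x)%:C.

Definition bary_monomial (R : realType) (m n : nat)
    (v : 'I_n.+1 -> 'rV[R]_m) (r : nat) (a : {ffun 'I_n.+1 -> 'I_r.+1})
    (x : 'rV[R]_m) : R[i] :=
  \prod_(i < n.+1) baryC v i x ^+ a i.

Definition bary_prod (R : realType) (m n : nat)
    (v : 'I_n.+1 -> 'rV[R]_m) (k : nat) (s : {ffun 'I_k -> 'I_n.+1})
    (x : 'rV[R]_m) : R[i] :=
  \prod_(i < k) baryC v (s i) x.

Definition dbary (R : realType) (m n : nat)
    (v : 'I_n.+1 -> 'rV[R]_m) (i : 'I_n.+1) : kform R m 1 := ext_deriv (bary v i).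

Definition dbary_wedge (R : realType) (m n : nat)
    (v : 'I_n.+1 -> 'rV[R]_m) (k : nat) (s : {ffun 'I_k -> 'I_n.+1}) : kform R m k :=
  wedges (fun i => dbary v (s i)).

Definition whitney (R : realType) (m n : nat)
    (v : 'I_n.+1 -> 'rV[R]_m) (l : nat) (s : {ffun 'I_l.+1 -> 'I_n.+1}) : kform R m l :=
  \sum_(p in image_set s)
    fscale (fun x => eps1 _ p (remove s p) * baryC v p x)
           (dbary_wedge v (remove s p)).

(* Main.v *)
Require Import Defs.
From mathcomp Require Import all_boot all_order all_algebra all_fingroup.
From mathcomp Require Import boolp functions reals topology normedtype derive.
From mathcomp Require Import complex ring.

(** Why the theorem holds.

Fix a point x of the simplex.  The coefficients of the first sum at x form a
cochain Om of degree k: a function of the subsets A of {0,...,n}, zero unless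
#|A| = k, that is, an element of the exterior algebra on generators e_0,...,e_n.
The value of a form on tangent vectors u is obtained by sending e_i to dlambda_i:
one pairs the cochain with the minors of the matrix (dlambda_i(u_j)), whose
columns sum to zero.  Three operators on cochains carry the argument:
- S (wedge_ones), the wedge product with e_0 + ... + e_n;
- E (contract), the contraction by the vector of barycentric coordinates
  lambda_i(x);
- H (hodge), the Hodge star weighted by products of the lambda_i(x).
They satisfy S S = 0 and E E = 0, and S E + E S = id because the lambda_i sum to
1 (wedge_contract).  Moreover E H = +- H S (contract_hodge).

The only relation between the dlambda_i is that their sum vanishes.  Accordingly
a cochain eta evaluates to the zero form exactly when S eta = 0
(eval_minors_eq0, wedge_ones_eval).  The first sum is the evaluation of Om, so it
vanishes at x if and only if S Om = 0.  Whitney forms are evaluations of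
contracted generators, so the second sum is the evaluation of E H Om
(second_sumE).  If S Om = 0, then E H Om = +- H S Om = 0.  Conversely, if the
second sum vanishes at x, then S E H Om = 0, hence
E H Om = (S E + E S) E H Om = 0, hence H S Om = 0; at an interior point the
weights of H are nonzero, so that S Om = 0 (wedge_ones_contract_hodge).

Thus the vanishing of either sum on the interior says S Om = 0 at all interior
points.  The entries of S Om are combinations of the monomials lambda^alpha with
coefficients S omega_alpha, and these monomials are linearly independent on the
interior (monomials_independent), so S omega_alpha = 0 for every alpha, which
in turn gives S Om = 0 at every point, boundary included.  The entries of
S omega_alpha at sets containing 0 are the expressions in the coefficient
condition, and they determine the others because S S = 0 (wedge_ones_eq0,
coefficient_conditionP). *)

Set Implicit Arguments.
Unset Strict Implicit.
Unset Printing Implicit Defensive.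

Import Order.TTheory GRing.Theory Num.Theory.
Import numFieldNormedType.Exports.

Local Open Scope ring_scope.
Local Open Scope complex_scope.

(** * Sorting signs *)

(** The contribution of one pair to the sign of a sequence in which a comes
    before b. It is 1 on the diagonal, so products over subsets need no side
    condition. *)
Definition inv_sign (F : comNzRingType) (n : nat) (a b : 'I_n.+1) : F :=
  (-1) ^+ (b < a)%N.

Definition set_sign1 (F : comNzRingType) (n : nat) (p : 'I_n.+1)
    (A : {set 'I_n.+1}) : F :=
  \prod_(a in A) inv_sign F p a.

Definition set_sign (F : comNzRingType) (n : nat) (A B : {set 'I_n.+1}) : F :=
  \prod_(a in A) set_sign1 F a B.

Lemma increasingP (k n : nat) (s : 'I_k -> 'I_n.+1) :
  reflect (forall i j : 'I_k, (i < j)%N -> (s i < s j)%N) (increasing s).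
Proof.
apply: (iffP forallP) => [inc i j|inc i].
  by move/forallP: (inc i) => /(_ j) /implyP.
by apply/forallP => j; apply/implyP; apply: inc.
Qed.

Lemma increasing_inj (k n : nat) (s : 'I_k -> 'I_n.+1) :
  increasing s -> injective s.
Proof.
move=> /increasingP lt i j sij; apply: val_inj; apply/eqP.
by case: ltngtP => // /lt; rewrite sij ltnn.
Qed.

Lemma card_image_set (k n : nat) (s : {ffun 'I_k -> 'I_n.+1}) :
  injective s -> #|image_set s| = k.
Proof.
move=> injs; rewrite -[RHS]card_ord -(card_codom injs).
by apply: eq_card => p; rewrite inE.
Qed.

Lemma big_image_set (T : Type) (idx : T) (op : Monoid.com_law idx)
    (k n : nat) (s : {ffun 'I_k -> 'I_n.+1}) (f : 'I_n.+1 -> T) :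
  injective s ->
  \big[op/idx]_(p in image_set s) f p = \big[op/idx]_(i < k) f (s i).
Proof.
move=> injs; rewrite -big_enum -[RHS](big_map s predT f) /=.
apply: perm_big; apply: uniq_perm; first exact: enum_uniq.
  by rewrite map_inj_uniq // /index_enum -enumT enum_uniq.
move=> p; rewrite mem_enum inE.
by apply/codomP/mapP => [[i ->]|[i _ ->]]; exists i; rewrite // mem_index_enum.
Qed.

(** Two increasing maps with the same image list the same elements in the same
    strict order. This lets sums over increasing maps be indexed by their
    images. *)
Lemma increasing_uniq (k n : nat) (s : {ffun 'I_k -> 'I_n.+1}) :
  increasing s -> s = incr_of_set k (image_set s).
Proof.
move=> incs; have injs := increasing_inj incs.
have [incr_t] := incr_of_setP (card_image_set injs).
set t := incr_of_set _ _ in incr_t * => im_t.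
have srt (u : {ffun 'I_k -> 'I_n.+1}) :
    increasing u -> sorted (relpre val ltn) (codom u).
  move=> incu; rewrite /codom /image_mem (map_comp u id) map_id sorted_map.
  apply: (@sub_sorted _ (relpre val ltn)).
    by move=> i j /=; apply/increasingP.
  by rewrite -sorted_map val_enum_ord iota_ltn_sorted.
have eqc : codom s = codom t.
  apply: (@irr_sorted_eq _ (relpre val ltn)).
  - by move=> a b c; apply: ltn_trans.
  - by move=> a; rewrite /= ltnn.
  - exact: srt.
  - by apply: srt; rewrite inE in incr_t.
  - by move=> p; move/setP: im_t => /(_ p); rewrite !inE.
apply/ffunP => i.
by move/eq_in_map: eqc; apply; rewrite mem_enum.
Qed.

Lemma sorting_perm (k n : nat) (s : {ffun 'I_k -> 'I_n.+1}) : injective s ->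
  exists2 p : 'S_k, increasing (fun i => s (p i))
    & forall C : pzRingType, sort_sign C s = (-1) ^+ p.
Proof.
move=> injs; suff [p0 incp0] : exists p : 'S_k, increasing (fun i => s (p i)).
  rewrite /sort_sign; case: pickP => [p incp|/(_ p0)]; last by rewrite incp0.
  by exists p.
have [incr_t] := incr_of_setP (card_image_set injs).
set t := incr_of_set _ _ in incr_t * => im_t; rewrite inE in incr_t.
have ex i : exists j, t i == s j.
  have : t i \in image_set t by rewrite inE codom_f.
  by rewrite im_t inE => /codomP [j ->]; exists j.
pose q i := xchoose (ex i).
have sq i : s (q i) = t i by apply/esym/eqP/(xchooseP (ex i)).
have injq : injective q.
  by move=> i j qij; apply: (increasing_inj incr_t); rewrite -!sq qij.
exists (perm injq); apply/increasingP => i j ij; rewrite !permE !sq.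
exact: (increasingP _ incr_t).
Qed.

(** Counting inversions: permuting the arguments of a Vandermonde determinant
    multiplies it by the sign of the permutation, and the determinant of the
    sorted sequence is positive, so the sign of the sorting permutation is the
    sign of the product of the differences s j - s i over i < j. *)
Lemma sort_signE (F : comNzRingType) (k n : nat) (s : {ffun 'I_k -> 'I_n.+1}) :
  injective s ->
  sort_sign F s = \prod_(i < k) \prod_(j < k | (i < j)%N) inv_sign F (s i) (s j).
Proof.
move=> injs; have [p incp ->] := sorting_perm injs.
pose V (a : {ffun 'I_k -> 'I_n.+1}) : int :=
  \prod_(i < k) \prod_(j < k | (i < j)%N) ((a j)%:Z - (a i)%:Z).
have VE a : V a = \det (Vandermonde k (\row_i (a i)%:Z)).
  rewrite det_Vandermonde /V.
  by apply: eq_bigr => i _; apply: eq_bigr => j _; rewrite !mxE.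
pose t := [ffun i => s (p i)].
have Vt : V t = V s * (-1) ^+ p.
  rewrite !VE -det_perm mulrC -[X in _ * X]det_tr -[LHS]det_tr -det_mulmx.
  rewrite -row_permE; congr (\det _).
  by apply/matrixP => i j; rewrite !mxE !ffunE.
have sgV (a : {ffun 'I_k -> 'I_n.+1}) : injective a -> Num.sg (V a) =
    \prod_(i < k) \prod_(j < k | (i < j)%N) inv_sign int (a i) (a j).
  move=> inja; rewrite (big_morph _ (@sgrM _) (sgr1 _)).
  apply: eq_bigr => i _; rewrite (big_morph _ (@sgrM _) (sgr1 _)).
  apply: eq_bigr => j ij; rewrite /inv_sign.
  case: ltngtP => [aji|aij|/val_inj/inja eij].
  - by rewrite expr1 ltr0_sg // subr_lt0 ltz_nat.
  - by rewrite expr0 gtr0_sg // subr_gt0 ltz_nat.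
  - by rewrite eij ltnn in ij.
have sgt : Num.sg (V t) = 1.
  rewrite gtr0_sg //; apply: prodr_gt0 => i _; apply: prodr_gt0 => j ij.
  rewrite subr_gt0 ltz_nat !ffunE.
  exact: (increasingP _ incp).
have E : (-1) ^+ p = \prod_(i < k) \prod_(j < k | (i < j)%N)
                        inv_sign int (s i) (s j).
  rewrite -sgV //; move: sgt; rewrite Vt sgrM.
  case: (odd_perm p); rewrite /= ?expr1 ?expr0 ?sgrN1 ?sgr1 ?mulrN1 ?mulr1 => // E.
  by rewrite -[RHS]opprK E.
transitivity (((-1) ^+ p : int)%:~R : F); first by rewrite rmorph_sign.
rewrite E rmorph_prod; apply: eq_bigr => i _; rewrite rmorph_prod.
by apply: eq_bigr => j _; rewrite rmorph_sign.
Qed.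

(** Within each of the two increasing blocks there is no inversion, so only the
    pairs with one entry in each block count. *)
Lemma eps_set_sign (F : comNzRingType) (k l n : nat)
    (s : {ffun 'I_k -> 'I_n.+1}) (t : {ffun 'I_l -> 'I_n.+1}) :
  increasing s -> increasing t -> [disjoint image_set s & image_set t] ->
  injective (concat s t) /\ eps F s t = set_sign F (image_set s) (image_set t).
Proof.
move=> incs inct dis.
have injs := increasing_inj incs; have injt := increasing_inj inct.
have nst i j : s i != t j.
  apply/eqP => E; move/pred0P: dis => /(_ (s i)) /=.
  by rewrite !inE codom_f E codom_f.
have catl i : concat s t (lshift l i) = s i by rewrite ffunE (unsplitK (inl i)).
have catr j : concat s t (rshift k j) = t j by rewrite ffunE (unsplitK (inr j)).
have inj : injective (concat s t).
  move=> a b; case: (splitP a) => i Ei; case: (splitP b) => j Ej.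
  - have -> : a = lshift l i by apply: val_inj.
    have -> : b = lshift l j by apply: val_inj.
    by rewrite !catl => /injs ->.
  - have -> : a = lshift l i by apply: val_inj.
    have -> : b = rshift k j by apply: val_inj.
    by rewrite catl catr => E; case/eqP: (nst i j).
  - have -> : a = rshift k i by apply: val_inj.
    have -> : b = lshift l j by apply: val_inj.
    by rewrite catl catr => E; case/eqP: (nst j i).
  - have -> : a = rshift k i by apply: val_inj.
    have -> : b = rshift k j by apply: val_inj.
    by rewrite !catr => /injt ->.
split=> //; rewrite /eps sort_signE // big_split_ord /=.
have inc1 (m : nat) (u : {ffun 'I_m -> 'I_n.+1}) (i j : 'I_m) :
    increasing u -> (i < j)%N -> inv_sign F (u i) (u j) = 1.
  by move=> /increasingP H /H {}H; rewrite /inv_sign ltnNge (ltnW H).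
rewrite [X in _ * X]big1 ?mulr1 => [|i _]; last first.
  rewrite big_split_ord /= !big1 ?mulr1 // => j.
    by rewrite ltn_add2l => ij; rewrite !catr (inc1 _ t).
  by rewrite ltnNge (leq_trans (ltnW (ltn_ord j))) // leq_addr.
rewrite /set_sign big_image_set //; apply: eq_bigr => i _.
rewrite big_split_ord /= big1 ?mul1r => [|j ij]; last by rewrite !catl (inc1 _ s).
rewrite /set_sign1 big_image_set //; apply: eq_big => [j|j _].
  by rewrite (leq_trans (ltn_ord i)) // leq_addr.
by rewrite catl catr.
Qed.

Lemma image_set_const (n : nat) (p : 'I_n.+1) :
  image_set [ffun _ : 'I_1 => p] = [set p].
Proof.
apply/setP => q; rewrite !inE; apply/codomP/eqP => [[i ->]|->].
  by rewrite ffunE.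
by exists ord0; rewrite ffunE.
Qed.

(** Together with the sign, this records that prepending p to the enumeration
    of A is an injective enumeration of p |: A, which is what the determinant
    lemmas need. *)
Lemma eps1_set_sign (F : comNzRingType) (l n : nat) (p : 'I_n.+1)
    (A : {set 'I_n.+1}) : #|A| = l -> p \notin A ->
  let f := concat [ffun _ : 'I_1 => p] (incr_of_set l A) in
  [/\ injective f, image_set f = p |: A &
      eps1 F p (incr_of_set l A) = set_sign1 F p A].
Proof.
move=> Al pA f; have [inct imt] := incr_of_setP Al; rewrite inE in inct.
have inc1 : increasing [ffun _ : 'I_1 => p].
  by apply/increasingP => i j; rewrite !ord1.
have [] := @eps_set_sign F 1 l n _ _ inc1 inct.
  by rewrite imt image_set_const disjoints1.
rewrite imt image_set_const -/f /set_sign big_set1 => injf E; split=> //.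
apply/setP => q; rewrite !inE -[in RHS]imt inE.
apply/codomP/orP => [[i ->]|].
  rewrite ffunE; case: fintype.split => j; [left|right]; last exact: codom_f.
  by rewrite ffunE.
case=> [/eqP ->|/codomP [j ->]].
  by exists (lshift l ord0); rewrite ffunE (unsplitK (inl ord0)) ffunE.
by exists (rshift 1 j); rewrite [RHS]ffunE (unsplitK (inr j)).
Qed.

(** The sorting sign is the factor by which a minor changes when its rows are
    put in increasing order. *)
Lemma det_rowsub_sort (F : comNzRingType) (k n : nat)
    (s : {ffun 'I_k -> 'I_n.+1}) (M : 'M[F]_(n.+1, k)) : injective s ->
  \det (rowsub s M) =
    sort_sign F s * \det (rowsub (incr_of_set k (image_set s)) M).
Proof.
move=> injs; have [p incp ->] := sorting_perm injs.
pose t := [ffun i => s (p i)].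
have inct : increasing t.
  by apply/increasingP => i j ij; rewrite !ffunE (increasingP _ incp).
have imt : image_set t = image_set s.
  apply/setP => q; rewrite !inE; apply/codomP/codomP => [[i ->]|[i ->]].
    by exists (p i); rewrite ffunE.
  by exists ((p^-1)%g i); rewrite ffunE permKV.
rewrite -imt -(increasing_uniq inct).
have -> : rowsub t M = perm_mx p *m rowsub s M.
  by rewrite -row_permE; apply/matrixP => i j; rewrite !mxE ffunE.
by rewrite det_mulmx det_perm mulrA -expr2 sqrr_sign mul1r.
Qed.

(** * The exterior algebra on n + 1 generators *)

Lemma inv_sign_flip (F : comNzRingType) (n : nat) (p q : 'I_n.+1) :
  p != q -> inv_sign F p q = - inv_sign F q p.
Proof.
rewrite /inv_sign -(inj_eq val_inj) /=.
by case: ltngtP => //= _ _; rewrite ?expr1 ?expr0 ?opprK.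
Qed.

Lemma inv_signK (F : comNzRingType) (n : nat) (p q : 'I_n.+1) :
  inv_sign F p q * inv_sign F p q = 1.
Proof. by rewrite -expr2 sqrr_sign. Qed.

Lemma set_sign1U1 (F : comNzRingType) (n : nat) (p q : 'I_n.+1)
    (A : {set 'I_n.+1}) :
  q \notin A -> set_sign1 F p (q |: A) = inv_sign F p q * set_sign1 F p A.
Proof. by move=> qA; rewrite /set_sign1 big_setU1. Qed.

Lemma set_signUl (F : comNzRingType) (n : nat) (p : 'I_n.+1)
    (A B : {set 'I_n.+1}) :
  p \notin A -> set_sign F (p |: A) B = set_sign1 F p B * set_sign F A B.
Proof. by move=> pA; rewrite /set_sign big_setU1. Qed.

(** Moving p from the right block past every element of A exchanges one pair
    for each of them, whence the power of -1. *)
Lemma set_signUr (F : comNzRingType) (n : nat) (p : 'I_n.+1)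
    (A B : {set 'I_n.+1}) : p \notin A -> p \notin B ->
  set_sign F A (p |: B) = (-1) ^+ #|A| * set_sign1 F p A * set_sign F A B.
Proof.
move=> pA pB; rewrite /set_sign /set_sign1 -prodr_const -!big_split /=.
apply: eq_bigr => a aA; rewrite big_setU1 //; congr (_ * _).
by rewrite inv_sign_flip ?mulN1r //; apply: contraNneq pA => <-.
Qed.

Lemma set_sign1_sqr (F : comNzRingType) (n : nat) (p : 'I_n.+1)
    (A : {set 'I_n.+1}) : set_sign1 F p A * set_sign1 F p A = 1.
Proof.
by rewrite /set_sign1 -big_split big1 // => a _; exact: inv_signK.
Qed.

Lemma set_sign_sqr (F : comNzRingType) (n : nat) (A B : {set 'I_n.+1}) :
  set_sign F A B * set_sign F A B = 1.
Proof.
by rewrite /set_sign -big_split big1 // => a _; exact: set_sign1_sqr.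
Qed.

Lemma setU1D1 (T : finType) (p q : T) (A : {set T}) :
  p != q -> (q |: A) :\ p = q |: (A :\ p).
Proof.
move=> pq; apply/setP => x; rewrite !inE.
by case: (eqVneq x q) => // ->; rewrite eq_sym pq.
Qed.

(** Pairs of a set and one of its elements correspond to pairs of a set and an
    element outside of it, by removing that element. *)
Lemma big_pair_remove_add (V : nmodType) (T : finType)
    (f : T -> {set T} -> V) :
  \sum_(A : {set T}) \sum_(p in A) f p A =
  \sum_(B : {set T}) \sum_(p in ~: B) f p (p |: B).
Proof.
rewrite (exchange_big_dep xpredT) //= [RHS](exchange_big_dep xpredT) //=.
apply: eq_bigr => p _.
rewrite (reindex_onto (fun B => p |: B) (fun A => A :\ p)) /=.
  apply: eq_bigl => B; rewrite !inE eqxx /=.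
  apply/eqP/idP => [<-|pB]; first by rewrite !inE eqxx.
  by rewrite setU1K.
by move=> A pA; rewrite setD1K.
Qed.

Lemma antisymmetric_sum (F : numDomainType) (I : finType) (P : pred I)
    (Q : rel I) (G : I -> I -> F) :
  (forall i j, P i -> Q i j -> P j && Q j i) ->
  (forall i j, P i -> Q i j -> G j i = - G i j) ->
  \sum_(i | P i) \sum_(j | Q i j) G i j = 0.
Proof.
move=> symPQ antiG; set X := LHS.
suff E : X = - X.
  have : X *+ 2 = 0 by rewrite mulr2n {1}E addNr.
  by move/eqP; rewrite mulrn_eq0 /= => /eqP.
rewrite {1}/X (exchange_big_dep P) /= => [|i j Pi Qij]; last first.
  by case/andP: (symPQ i j Pi Qij).
rewrite /X -sumrN; apply: eq_bigr => j Pj; rewrite -sumrN.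
apply: eq_big => [i|i /andP [Pi Qij]]; last first.
  by rewrite [G j i]antiG ?opprK.
apply/andP/idP => [[Pi Qij]|Qji]; first by case/andP: (symPQ i j Pi Qij).
by apply/andP; exact: symPQ.
Qed.

(** The coefficient of e_A in (e_0 + ... + e_n) /\ eta. Cochains are functions
    of all subsets; the degree is not built into the type, so that this
    operator and the next two compose freely. *)
Definition wedge_ones (F : comNzRingType) (n : nat) (eta : {set 'I_n.+1} -> F)
    (A : {set 'I_n.+1}) : F :=
  \sum_(p in A) set_sign1 F p (A :\ p) * eta (A :\ p).

(** The interior product with lam: e_p /\ e_A is sent to lam p e_A plus the
    terms that keep e_p. *)
Definition contract (F : comNzRingType) (n : nat) (lam : 'I_n.+1 -> F)
    (eta : {set 'I_n.+1} -> F) (A : {set 'I_n.+1}) : F :=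
  \sum_(p in ~: A) set_sign1 F p A * lam p * eta (p |: A).

(** The Hodge star, composed with the diagonal map that scales each e_i by lam
    i. The sign is the one that appears in the second sum. *)
Definition hodge (F : comNzRingType) (n : nat) (lam : 'I_n.+1 -> F)
    (eta : {set 'I_n.+1} -> F) (A : {set 'I_n.+1}) : F :=
  set_sign F (~: A) A * (\prod_(a in ~: A) lam a) * eta (~: A).

(** Adjoining p and then q, or q and then p, gives opposite signs. *)
Lemma wedge_ones_sqr (F : numDomainType) (n : nat)
    (eta : {set 'I_n.+1} -> F) (A : {set 'I_n.+1}) :
  wedge_ones (wedge_ones eta) A = 0.
Proof.
rewrite /wedge_ones; under eq_bigr do rewrite mulr_sumr.
apply: antisymmetric_sum => [p q pA|p q pA]; rewrite !inE => /andP [qp qA].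
  by rewrite eq_sym qp pA qA.
have -> : A :\ q :\ p = A :\ p :\ q by apply/setP => x; rewrite !inE andbCA.
set B := A :\ p :\ q.
have -> : A :\ q = p |: B.
  by rewrite /B -setU1D1 // setD1K.
have -> : A :\ p = q |: B by rewrite /B setD1K // !inE qp.
rewrite !set_sign1U1 ?inE ?eqxx ?andbF // inv_sign_flip //.
ring.
Qed.

Lemma contract_sqr (F : numDomainType) (n : nat) (lam : 'I_n.+1 -> F)
    (eta : {set 'I_n.+1} -> F) (A : {set 'I_n.+1}) :
  contract lam (contract lam eta) A = 0.
Proof.
rewrite /contract; under eq_bigr do rewrite mulr_sumr.
apply: antisymmetric_sum => [p q|p q]; rewrite !inE ?negb_or => pA.
  by move=> /andP [qp qA]; rewrite eq_sym qp pA qA.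
move=> /andP [qp qA].
have -> : p |: (q |: A) = q |: (p |: A) by rewrite setUCA.
by rewrite !set_sign1U1 // (inv_sign_flip F qp); ring.
Qed.

(** The homotopy formula of the Koszul complex: the terms that remove and add
    the same index give the sum of lam, and those with two distinct indices
    cancel because exchanging the two steps changes the sign. *)
Lemma wedge_contract (F : numDomainType) (n : nat) (lam : 'I_n.+1 -> F)
    (eta : {set 'I_n.+1} -> F) (A : {set 'I_n.+1}) :
  wedge_ones (contract lam eta) A + contract lam (wedge_ones eta) A =
  (\sum_p lam p) * eta A.
Proof.
(* The terms in which the removed index p and the added index q differ. *)
pose off p q := set_sign1 F p (A :\ p) *
  (set_sign1 F q (A :\ p) * lam q * eta (q |: (A :\ p))).
have -> : wedge_ones (contract lam eta) A =
    \sum_(p in A) lam p * eta A + \sum_(p in A) \sum_(q in ~: A) off p q.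
  rewrite /wedge_ones -big_split /=; apply: eq_bigr => p pA.
  rewrite /contract setCD setUC big_setU1 ?inE ?pA //= mulrDr setD1K //.
  by rewrite mulrA mulrA set_sign1_sqr mul1r mulr_sumr.
have -> : contract lam (wedge_ones eta) A =
    \sum_(p in ~: A) lam p * eta A - \sum_(p in A) \sum_(q in ~: A) off p q.
  rewrite [X in _ - X](exchange_big_dep (mem (~: A))) //= -sumrB.
  apply: eq_bigr => q; rewrite inE => qA.
  rewrite /wedge_ones big_setU1 //= setU1K // mulrDr; congr (_ + _).
    by rewrite mulrACA set_sign1_sqr mul1r.
  rewrite mulr_sumr -sumrN; apply: eq_big => [p|p pA]; first by rewrite qA andbT.
  have qp : q != p by apply: contraNneq qA => ->.
  rewrite setU1D1 1?[p == q]eq_sym // set_sign1U1 ?inE ?(negPf qA) ?andbF //.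
  rewrite /off -{1}(setD1K pA) set_sign1U1 ?inE ?eqxx //.
  by rewrite (inv_sign_flip F qp) -[RHS]mul1r -(inv_signK F p q); ring.
rewrite addrACA subrr addr0 -!mulr_suml -mulrDl; congr (_ * _).
by rewrite [RHS](bigID (mem A)) /=; congr (_ + _); apply: eq_bigl => p; rewrite inE.
Qed.

(** The Hodge star exchanges wedging with contraction. Contracting with weights
    lam compensates the factor lam p that is lost when p leaves the complement
    of A, so that wedging with the unweighted vector e_0 + ... + e_n appears on
    the right. *)
Lemma contract_hodge (F : comNzRingType) (n : nat) (lam : 'I_n.+1 -> F)
    (eta : {set 'I_n.+1} -> F) (A : {set 'I_n.+1}) :
  contract lam (hodge lam eta) A =
  (-1) ^+ #|~: A|.-1 * hodge lam (wedge_ones eta) A.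
Proof.
rewrite /contract /hodge /wedge_ones !mulr_sumr; apply: eq_bigr => p pA.
have pA' : p \notin A by rewrite inE in pA.
have -> : ~: (p |: A) = ~: A :\ p by apply/setP => x; rewrite !inE negb_or.
rewrite set_signUr ?inE ?eqxx // (cardsD1 p (~: A)) pA /=.
rewrite -[in set_sign F (~: A) A](setD1K pA) set_signUl ?inE ?eqxx //.
rewrite [\prod_(a in ~: A) lam a](big_setD1 p) //=.
ring.
Qed.

(** * Evaluating cochains by minors *)

(** With these weights, contraction is the simplest homotopy for wedge_ones: it
    reads off the coefficients at the sets that contain 0. *)
Definition delta0 (F : comNzRingType) (n : nat) (i : 'I_n.+1) : F :=
  (i == ord0)%:R.

Lemma sum_delta0 (F : comNzRingType) (n : nat) : \sum_p @delta0 F n p = 1.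
Proof.
by rewrite (bigD1 ord0) //= big1 ?addr0 // /delta0 => i /negPf ->.
Qed.

Lemma set_sign1_ord0 (F : comNzRingType) (n : nat) (A : {set 'I_n.+1}) :
  set_sign1 F ord0 A = 1.
Proof. by rewrite /set_sign1 big1 // => a _; rewrite /inv_sign ltn0. Qed.

Lemma contract_delta0 (F : comNzRingType) (n : nat) (eta : {set 'I_n.+1} -> F)
    (A : {set 'I_n.+1}) :
  contract (@delta0 F n) eta A = if ord0 \in A then 0 else eta (ord0 |: A).
Proof.
rewrite /contract; case: ifPn => A0.
  apply: big1 => p; rewrite inE => pA.
  have /negPf p0 : p != ord0 by apply: contraNneq pA => ->.
  by rewrite /delta0 p0 mulr0 mul0r.
rewrite (bigD1 ord0) ?inE //= big1 ?addr0 => [|p /andP [_ /negPf p0]].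
  by rewrite /delta0 eqxx set_sign1_ord0 !mul1r.
by rewrite /delta0 p0 mulr0 mul0r.
Qed.

Lemma wedge_ones0 (F : comNzRingType) (n : nat) (eta : {set 'I_n.+1} -> F)
    (A : {set 'I_n.+1}) :
  (forall B, eta B = 0) -> wedge_ones eta A = 0.
Proof. by move=> E; apply: big1 => p _; rewrite E mulr0. Qed.

Lemma contract0 (F : comNzRingType) (n : nat) (lam : 'I_n.+1 -> F)
    (eta : {set 'I_n.+1} -> F) (A : {set 'I_n.+1}) :
  (forall B, eta B = 0) -> contract lam eta A = 0.
Proof. by move=> E; apply: big1 => p _; rewrite E mulr0. Qed.

(** Since wedge_ones squares to zero, its values are closed, hence recovered by
    the homotopy formula from the coefficients at the sets that contain 0. *)
Lemma wedge_ones_eq0 (F : numDomainType) (n : nat) (eta : {set 'I_n.+1} -> F) :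
  (forall A : {set 'I_n.+1}, ord0 \notin A -> wedge_ones eta (ord0 |: A) = 0) ->
  forall A, wedge_ones eta A = 0.
Proof.
move=> H A.
rewrite -[LHS]mul1r -(sum_delta0 F n) -wedge_contract wedge_ones0 => [|B].
  by rewrite add0r contract0 // => B; rewrite wedge_ones_sqr.
by rewrite contract_delta0; case: ifPn => // /H.
Qed.

Lemma contract_hodge_eq0 (F : numDomainType) (n : nat) (lam : 'I_n.+1 -> F)
    (eta : {set 'I_n.+1} -> F) :
  (forall A, wedge_ones eta A = 0) ->
  forall A, contract lam (hodge lam eta) A = 0.
Proof. by move=> H A; rewrite contract_hodge /hodge H !mulr0. Qed.

(** If contract (hodge eta) is closed, the homotopy formula and the vanishing
    of contract twice force it to be zero. It is a signed multiple of hodge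
    (wedge_ones eta), and hodge is injective for nonzero weights. *)
Lemma wedge_ones_contract_hodge (F : numDomainType) (n : nat)
    (lam : 'I_n.+1 -> F) (eta : {set 'I_n.+1} -> F) :
  \sum_i lam i = 1 -> (forall i, lam i != 0) ->
  (forall A, wedge_ones (contract lam (hodge lam eta)) A = 0) ->
  forall A, wedge_ones eta A = 0.
Proof.
move=> lam1 lam0 H A.
have : contract lam (hodge lam eta) (~: A) = 0.
  rewrite -[LHS]mul1r -lam1 -wedge_contract contract0 // addr0.
  by rewrite wedge_ones0 // => B; exact: contract_sqr.
rewrite contract_hodge /hodge setCK => /eqP.
rewrite !mulf_eq0 signr_eq0 /= => /orP [/orP [/eqP s0|]|/eqP //].
  have := set_sign_sqr F A (~: A); rewrite s0 mulr0 => /esym/eqP.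
  by rewrite oner_eq0.
by rewrite prodf_seq_eq0 => /hasP [i _] /andP [_ /eqP i0]; case/eqP: (lam0 i).
Qed.

Definition minor (F : comNzRingType) (n k : nat) (M : 'M[F]_(n.+1, k))
    (A : {set 'I_n.+1}) : F :=
  \det (rowsub (incr_of_set k A) M).

(** The value of the form obtained from eta by sending e_i to the i-th row of
    M, for M the matrix of the values of the 1-forms on k vectors. *)
Definition eval_minors (F : comNzRingType) (n k : nat) (M : 'M[F]_(n.+1, k))
    (eta : {set 'I_n.+1} -> F) : F :=
  \sum_(A : {set 'I_n.+1} | #|A| == k) eta A * minor M A.

(** The cofactors of a row placed above the rows of M with index in B. They do
    not depend on that row, so they express the determinant as a linear
    function of it. *)
Definition cons_row_cofactor (F : comNzRingType) (n l : nat)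
    (M : 'M[F]_(n.+1, l.+1)) (B : {set 'I_n.+1}) (j : 'I_l.+1) : F :=
  (-1) ^+ j * minor (col' j M) B.

Lemma det_cons_row (F : comNzRingType) (n l : nat)
    (M : 'M[F]_(n.+1, l.+1)) (B : {set 'I_n.+1}) (p : 'I_n.+1) :
  \det (rowsub (concat [ffun _ : 'I_1 => p] (incr_of_set l B)) M) =
  \sum_j M p j * cons_row_cofactor M B j.
Proof.
rewrite (expand_det_row _ ord0); apply: eq_bigr => j _.
rewrite !mxE; congr (M _ _ * _).
  rewrite ffunE (_ : ord0 = lshift l ord0 :> 'I_(1 + l)); last exact: val_inj.
  by rewrite (unsplitK (inl ord0)) ffunE.
rewrite /cofactor add0n /cons_row_cofactor /minor; congr (_ * \det _).
apply/matrixP => i k; rewrite !mxE; congr (M _ _).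
rewrite [LHS]ffunE (_ : lift ord0 i = rshift 1 i); last exact: val_inj.
by rewrite (unsplitK (inr i)).
Qed.

Lemma minor_setU1 (F : comNzRingType) (n l : nat) (M : 'M[F]_(n.+1, l.+1))
    (B : {set 'I_n.+1}) (p : 'I_n.+1) : #|B| = l -> p \notin B ->
  set_sign1 F p B * minor M (p |: B) =
  \sum_j M p j * cons_row_cofactor M B j.
Proof.
move=> Bl pB; have [injf imf E] := @eps1_set_sign F l n p B Bl pB.
by rewrite -det_cons_row det_rowsub_sort // imf -E.
Qed.

(** A determinant with a repeated row vanishes. *)
Lemma cofactor_sum_repeated_row (F : comNzRingType) (n l : nat)
    (M : 'M[F]_(n.+1, l.+1))
    (B : {set 'I_n.+1}) (p : 'I_n.+1) : #|B| = l -> p \in B ->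
  \sum_j M p j * cons_row_cofactor M B j = 0.
Proof.
move=> Bl pB; have [_ imt] := incr_of_setP Bl.
have : p \in image_set (incr_of_set l B) by rewrite imt.
rewrite inE => /codomP [i pE]; rewrite -det_cons_row.
apply: (@determinant_alternate _ _ _ (lshift l ord0) (rshift 1 i)) => // j.
rewrite !mxE; congr (M _ _).
by rewrite [LHS]ffunE [RHS]ffunE (unsplitK (inl ord0)) (unsplitK (inr i)) ffunE.
Qed.

(** Expanding along a row placed on top, the terms coming from one e_B add up
    to a determinant whose first row is the sum of all the rows of M, that is,
    zero. *)
Lemma eval_minors_wedge_ones (F : comNzRingType) (n k : nat)
    (M : 'M[F]_(n.+1, k)) (zeta : {set 'I_n.+1} -> F) :
  (forall j, \sum_i M i j = 0) -> eval_minors M (wedge_ones zeta) = 0.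
Proof.
move=> M0; case: k => [|l] in M M0 *.
  apply: big1 => A /eqP /cards0_eq ->.
  by rewrite /wedge_ones big_set0 mul0r.
rewrite /eval_minors big_mkcond /=.
pose f p (A : {set 'I_n.+1}) := if #|A| == l.+1 then
  set_sign1 F p (A :\ p) * zeta (A :\ p) * minor M A else 0.
transitivity (\sum_(A : {set 'I_n.+1}) \sum_(p in A) f p A).
  apply: eq_bigr => A _; rewrite /f; case: ifP => _.
    by rewrite /wedge_ones mulr_suml.
  by rewrite big1.
rewrite big_pair_remove_add big1 // => B _; rewrite /f.
have [Bl|Bl] := eqVneq #|B| l; last first.
  apply: big1 => p; rewrite inE => pB.
  by rewrite cardsU1 pB add1n eqSS (negPf Bl).
  (* The rows p in B may be added, since their determinants vanish. *)
  transitivity (\sum_p zeta B * \sum_j M p j * cons_row_cofactor M B j).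
  rewrite [RHS](bigID (mem B)) /= [X in _ = X + _]big1 ?add0r; last first.
    by move=> p pB; rewrite cofactor_sum_repeated_row // mulr0.
  apply: eq_big => p; rewrite inE // => pB.
  rewrite -minor_setU1 // cardsU1 pB add1n eqSS Bl eqxx setU1K //.
  by rewrite mulrCA mulrA.
rewrite -mulr_sumr exchange_big big1 ?mulr0 // => j _.
by rewrite -mulr_suml M0 mul0r.
Qed.

(** Eliminating row 0. By the homotopy formula with weights delta0, eta differs
    from the cochain whose coefficients are displayed on the right by some
    wedge_ones zeta, which evaluates to zero. *)
Lemma eval_minors_reduce (F : numDomainType) (n k : nat)
    (M : 'M[F]_(n.+1, k)) (eta : {set 'I_n.+1} -> F) :
  (forall j, \sum_i M i j = 0) ->
  eval_minors M eta =
  \sum_(A : {set 'I_n.+1} | (#|A| == k) && (ord0 \notin A))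
    wedge_ones eta (ord0 |: A) * minor M A.
Proof.
move=> M0; pose d := @delta0 F n.
have E A : eta A = wedge_ones (contract d eta) A + contract d (wedge_ones eta) A.
  by rewrite wedge_contract sum_delta0 mul1r.
transitivity (eval_minors M (wedge_ones (contract d eta)) +
              eval_minors M (contract d (wedge_ones eta))).
  by rewrite -big_split; apply: eq_bigr => A _; rewrite /= -mulrDl -E.
rewrite eval_minors_wedge_ones // add0r [RHS]big_mkcondr.
apply: eq_bigr => A _.
by rewrite contract_delta0; case: ifP; rewrite /= ?mul0r.
Qed.

(** The values of the dlambda_i on the edges from vertex 0 to the vertices with
    index in A. *)
Definition frame (F : comNzRingType) (n k : nat) (A : {set 'I_n.+1}) :
    'M[F]_(n.+1, k) :=
  \matrix_(i, j) ((i == incr_of_set k A j)%:R - (i == ord0)%:R).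

Lemma frame_colsum (F : comNzRingType) (n k : nat) (A : {set 'I_n.+1})
    (j : 'I_k) : \sum_i frame F k A i j = 0.
Proof.
have E (a : 'I_n.+1) : \sum_i (i == a)%:R = 1 :> F.
  by rewrite (bigD1 a) //= eqxx big1 ?addr0 // => i /negPf ->.
by under eq_bigr do rewrite mxE; rewrite big_split /= sumrN !E subrr.
Qed.

(** The edges from vertex 0 form a basis of the tangent space dual to the
    dlambda_i with i nonzero. *)
Lemma minor_frame (F : comNzRingType) (n k : nat) (A B : {set 'I_n.+1}) :
  #|A| = k -> #|B| = k -> ord0 \notin B ->
  minor (frame F k A) B = (B == A)%:R.
Proof.
move=> Ak Bk B0; have [incB imB] := incr_of_setP Bk.
have [incA imA] := incr_of_setP Ak.
have inB i : incr_of_set k B i \in B.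
  have : incr_of_set k B i \in image_set (incr_of_set k B) by rewrite inE codom_f.
  by rewrite imB.
have neq0 i : (incr_of_set k B i == ord0) = false.
  by apply/negP => /eqP E; move: B0; rewrite -E inB.
have [eqBA|neqBA] := eqVneq B A.
  rewrite /minor -[RHS](det1 F k) (_ : rowsub _ _ = 1%:M) //.
  apply/matrixP => i j; rewrite !mxE neq0 subr0 -eqBA inj_eq //.
  by apply: increasing_inj; rewrite inE in incB.
(* A row of the minor with index in B but not in A is zero. *)
have [b bB bA] : exists2 b, b \in B & b \notin A.
  apply/subsetPn; apply: contraNN neqBA => BA.
  by rewrite eqEcard BA Ak Bk leqnn.
have : b \in image_set (incr_of_set k B) by rewrite imB.
rewrite inE => /codomP [i bE].
rewrite /minor (expand_det_row _ i) big1 // => j _; rewrite !mxE neq0 subr0.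
rewrite -bE; case: eqP => [E|]; last by rewrite mul0r.
by move: bA; rewrite E -{2}imA inE codom_f.
Qed.

(** The edge vectors leaving vertex 0 suffice to detect a nonzero form:
    evaluated on the frame of A, only the coefficient at A survives after the
    elimination of row 0. *)
Lemma wedge_ones_eval (F : numDomainType) (n k : nat)
    (eta : {set 'I_n.+1} -> F) :
  (forall A : {set 'I_n.+1}, #|A| != k -> eta A = 0) ->
  (forall A : {set 'I_n.+1}, #|A| = k -> ord0 \notin A ->
    eval_minors (frame F k A) eta = 0) ->
  forall A, wedge_ones eta A = 0.
Proof.
move=> deg_eta H; apply: wedge_ones_eq0 => A A0.
have [Ak|Ak] := eqVneq #|A| k; last first.
  rewrite /wedge_ones big1 // => p pA; rewrite deg_eta ?mulr0 //.
  have := cardsD1 p (ord0 |: A); rewrite pA cardsU1 A0 => /eqP.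
  by rewrite eqn_add2l => /eqP <-.
have := H A Ak A0; rewrite eval_minors_reduce; last exact: frame_colsum.
rewrite (bigD1 A) ?Ak ?eqxx //= minor_frame // eqxx mulr1 big1 ?addr0 //.
move=> B /andP [/andP [/eqP Bk B0] /negPf BA].
by rewrite minor_frame // BA mulr0.
Qed.

Lemma eval_minors_eq0 (F : numDomainType) (n k : nat)
    (M : 'M[F]_(n.+1, k)) (eta : {set 'I_n.+1} -> F) :
  (forall j, \sum_i M i j = 0) -> (forall A, wedge_ones eta A = 0) ->
  eval_minors M eta = 0.
Proof.
move=> M0 H; rewrite eval_minors_reduce // big1 // => A _.
by rewrite H mul0r.
Qed.

(** * Independence of the Bernstein monomials *)

(** Uniqueness of the expansion in base b. *)
Lemma digits_inj (b n : nat) (f g : 'I_n -> nat) :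
  (forall i, (f i < b)%N) -> (forall i, (g i < b)%N) ->
  (\sum_i f i * b ^ i = \sum_i g i * b ^ i)%N -> f =1 g.
Proof.
elim: n f g => [|n IH] f g fb gb; first by move=> _ [].
have E (h : 'I_n.+1 -> nat) : (\sum_i h i * b ^ i =
    (\sum_(i < n) h (lift ord0 i) * b ^ i) * b + h ord0)%N.
  rewrite big_ord_recl expn0 muln1 addnC; congr (_ + _)%N.
  rewrite big_distrl; apply: eq_bigr => i _.
  by rewrite /= /bump leq0n add1n expnSr mulnA.
rewrite !E => H; have b0 : (0 < b)%N by apply: leq_trans (fb ord0).
have H0 : f ord0 = g ord0.
  by move: (congr1 (modn^~ b) H); rewrite !modnMDl !modn_small.
move: H; rewrite H0 => /addIn/eqP; rewrite eqn_pmul2r // => /eqP /IH H i.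
case: (unliftP ord0 i) => [j|] -> //; exact: H.
Qed.

Lemma poly_eq0_of_pos (R : rcfType) (p : {poly R[i]}) :
  (forall y : R, 0 < y -> p.[y%:C] = 0) -> p = 0.
Proof.
move=> H; apply/eqP; apply: contraT => p0.
pose rs : seq R[i] := [seq (j.+1)%:R | j <- iota 0 (size p)].
have := max_poly_roots p0 (rs := rs); rewrite size_map size_iota ltnn; apply.
  apply/allP => _ /mapP [j _ ->]; rewrite /root.
  by rewrite -(rmorph_nat (real_complex R)) H // ltr0Sn.
by rewrite map_inj_uniq ?iota_uniq // => i j /eqP; rewrite eqr_nat => /eqP [].
Qed.

(** By homogeneity the relation extends from the open simplex to all positive
    t. Substituting t_i = y ^ ((r+1) ^ i) (Kronecker) turns the monomial with
    exponents a, all at most r, into the power of y whose exponent has digits a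
    in base r+1. Distinct monomials become distinct powers of one variable, and
    a univariate polynomial that vanishes at all positive reals is zero. *)
Lemma monomials_independent (R : realType) (r n : nat)
    (c : {ffun 'I_n.+1 -> 'I_r.+1} -> R[i]) :
  (forall t : 'I_n.+1 -> R, (forall i, 0 < t i) -> \sum_i t i = 1 ->
     \sum_(a in multi_indices r n) c a * \prod_i (t i)%:C ^+ a i = 0) ->
  forall a, a \in multi_indices r n -> c a = 0.
Proof.
move=> H; pose code (a : {ffun 'I_n.+1 -> 'I_r.+1}) := (\sum_i a i * r.+1 ^ i)%N.
have code_inj a b : code a = code b -> a = b.
  by move=> /digits_inj E; apply/ffunP => i; apply: val_inj; apply: E.
have Hpos (t : 'I_n.+1 -> R) : (forall i, 0 < t i) ->
    \sum_(a in multi_indices r n) c a * \prod_i (t i)%:C ^+ a i = 0.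
  (* Normalising t multiplies every monomial by the same power of its sum. *)
  move=> t0; pose s := \sum_i t i.
  have s0 : 0 < s.
    rewrite /s (bigD1 ord0) //= ltr_wpDr // sumr_ge0 // => i _; exact: ltW.
  have := H (fun i => t i / s) (fun i => divr_gt0 (t0 i) s0).
  rewrite -mulr_suml divff ?gt_eqF // => /(_ erefl).
  move=> /(congr1 ( *%R (s%:C ^+ r))); rewrite mulr0 mulr_sumr => E.
  rewrite -[RHS]E.
  apply: eq_bigr => a; rewrite inE => /eqP ar.
  rewrite mulrCA; congr (_ * _).
  have -> : s%:C ^+ r = \prod_i s%:C ^+ a i by rewrite prodrXr ar.
  rewrite -big_split /=.
  apply: eq_bigr => i _; rewrite -exprMn -rmorphM; congr (_%:C ^+ _).
  by rewrite mulrCA divff ?mulr1 // gt_eqF.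
(* Evaluating p at y is the Kronecker substitution. *)
pose p : {poly R[i]} := \sum_(a in multi_indices r n) c a *: 'X^(code a).
have p0 : p = 0.
  apply: poly_eq0_of_pos => y y0; rewrite horner_sum.
  rewrite -[RHS](Hpos (fun i => y ^+ (r.+1 ^ i))) => [|i]; last exact: exprn_gt0.
  apply: eq_bigr => a _; rewrite hornerZ hornerXn; congr (_ * _).
  rewrite /code -prodrXr; apply: eq_bigr => i _.
  by rewrite rmorphXn /= -exprM mulnC.
move=> a am; have := congr1 (fun q : {poly R[i]} => q`_(code a)) p0.
rewrite coef0 coef_sum (bigD1 a) //= coefZ coefXn eqxx mulr1 big1 ?addr0 //.
move=> b /andP [_ /eqP ba]; rewrite coefZ coefXn.
by case: eqP => [/code_inj E|]; rewrite ?mulr0 //; case: ba.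
Qed.

(** * Barycentric coordinates and wedge products *)

(** The iterated wedge product sums over all permutations of k+1 vectors with
    the factor 1/k!; each permutation of the last k arguments, absorbed into
    the outer one, reproduces the Leibniz formula once. *)
Lemma wedges_det (R : realType) (m k : nat) (a : 'I_k -> kform R m 1)
    (x : 'rV[R]_m) (u : 'I_k -> 'rV[R]_m) :
  wedges a x u = \det (\matrix_(i, j) a i x (fun _ => u j)).
Proof.
elim: k a u => [|k IH] a u; first by rewrite /= det_mx00.
pose D := \det (\matrix_(i, j) a i x (fun _ => u j)).
rewrite /= /wedge (_ : 1`! = 1)%N // mul1n.
apply: (canLR (mulKf _)); first by rewrite pnatr_eq0 -lt0n fact_gt0.
(* Each inner permutation t contributes one copy of the determinant D. *)
transitivity (\sum_(t : 'S_k) D); last first.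
  by rewrite sumr_const card_Sn mulr_natl.
transitivity (\sum_(s : 'S_(1 + k)) \sum_(t : 'S_k)
    (-1) ^+ (lift0_perm t * s)%g *
    \prod_i a i x (fun _ => u ((lift0_perm t * s)%g i))).
  apply: eq_bigr => s _; rewrite IH /determinant !mulr_sumr.
  apply: eq_bigr => t _; rewrite odd_permM signr_addb odd_lift_perm addbF.
  rewrite big_ord_recl permM lift0_perm0 /=.
  have -> : (fun i => u (s (lshift k i))) = (fun _ => u (s 0)).
    apply: funext => i; rewrite ord1.
    by congr (u (s _)); apply: val_inj.
  rewrite mulrCA [LHS]mulrA [LHS]mulrCA [RHS]mulrCA -!mulrA.
  rewrite [RHS]mulrCA; congr (_ * (_ * (_ * _))).
  by apply: eq_bigr => i _; rewrite mxE permM lift0_perm_lift; congr (a _ x _);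
    apply: funext => _; congr (u (s _)); apply: val_inj.
rewrite exchange_big; apply: eq_bigr => t _ /=.
rewrite (reindex_inj (@mulgI _ (lift0_perm t)^-1%g)) /D /determinant /=.
apply: eq_bigr => s _; rewrite mulKVg; congr (_ * _).
by apply: eq_bigr => i _; rewrite mxE.
Qed.

(** The linear part of the affine function bary v i. *)
Definition dbary_lin (R : realType) (m n : nat) (v : 'I_n.+1 -> 'rV[R]_m)
    (i : 'I_n.+1) (u : 'rV[R]_m) : R :=
  if unlift ord0 i is Some j then coord (edges v) j u
  else - \sum_(j < n) coord (edges v) j u.

Lemma bary_shift (R : realType) (m n : nat) (v : 'I_n.+1 -> 'rV[R]_m)
    (i : 'I_n.+1) (h : R) (u x : 'rV[R]_m) :
  bary v i (h *: u + x) = bary v i x + h * dbary_lin v i u.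
Proof.
rewrite /bary /dbary_lin -addrA; case: unlift => [j|].
  by rewrite linearD linearZ /= [LHS]addrC.
rewrite -addrA mulrN -opprD; congr (_ - _).
rewrite mulr_sumr -big_split; apply: eq_bigr => j _.
by rewrite linearD linearZ /= [LHS]addrC.
Qed.

(** The difference quotient of an affine function is constant. *)
Lemma dbaryE (R : realType) (m n : nat) (v : 'I_n.+1 -> 'rV[R]_m)
    (i : 'I_n.+1) (x : 'rV[R]_m) (u : 'I_1 -> 'rV[R]_m) :
  dbary v i x u = (dbary_lin v i (u ord0))%:C.
Proof.
rewrite /dbary /ext_deriv /derive; congr (_%:C); apply: cvg_lim => //.
apply: cvg_near_cst; near=> h.
rewrite /= bary_shift [_ + h * _]addrC addrK.
rewrite -[_ *: _]/(_ * _) mulKf //.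
near: h; exact: nbhs_dnbhs_neq.
Unshelve. all: by end_near. Qed.

Lemma sum_dbary_lin (R : realType) (m n : nat) (v : 'I_n.+1 -> 'rV[R]_m)
    (u : 'rV[R]_m) : \sum_i dbary_lin v i u = 0.
Proof.
rewrite big_ord_recl /dbary_lin unlift_none; apply/eqP; rewrite addr_eq0.
by apply/eqP; congr (- _); apply: eq_bigr => i _; rewrite liftK.
Qed.

Lemma sum_bary (R : realType) (m n : nat) (v : 'I_n.+1 -> 'rV[R]_m)
    (x : 'rV[R]_m) : \sum_i bary v i x = 1.
Proof.
rewrite big_ord_recl /bary unlift_none.
rewrite -[RHS](subrK (\sum_(j < n) coord (edges v) j (x - v ord0))).
by congr (_ + _); apply: eq_bigr => i _; rewrite liftK.
Qed.

Lemma dbary_lin_vertex (R : realType) (m n : nat) (v : 'I_n.+1 -> 'rV[R]_m)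
    (i a : 'I_n.+1) : affinely_independent v ->
  dbary_lin v i (v a - v ord0) = (i == a)%:R - (i == ord0)%:R.
Proof.
move=> hv; rewrite -!(bary_vertex _ _ hv).
have := bary_shift v i 1 (v a - v ord0) (v ord0).
by rewrite scale1r subrK mul1r => ->; rewrite [RHS]addrAC subrr add0r.
Qed.

Lemma bary_combination (R : realType) (m n : nat) (v : 'I_n.+1 -> 'rV[R]_m)
    (t : 'I_n.+1 -> R) (i : 'I_n.+1) : affinely_independent v ->
  \sum_j t j = 1 -> bary v i (\sum_j t j *: v j) = t i.
Proof.
move=> hv t1.
have linE : dbary_lin v i (\sum_j t j *: (v j - v ord0)) =
    \sum_j t j * dbary_lin v i (v j - v ord0).
  rewrite /dbary_lin; case: unlift => [b|].
    by rewrite linear_sum; apply: eq_bigr => j _; rewrite linearZ.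
  under eq_bigr do rewrite linear_sum; rewrite exchange_big -sumrN.
  apply: eq_bigr => j _; rewrite mulrN mulr_sumr; congr (- _).
  by apply: eq_bigr => b _; rewrite linearZ.
have -> : \sum_j t j *: v j = 1 *: (\sum_j t j *: (v j - v ord0)) + v ord0.
  under [in RHS]eq_bigr do rewrite scalerBr.
  by rewrite big_split /= sumrN -scaler_suml t1 !scale1r subrK.
rewrite bary_shift linE mul1r bary_vertex //.
under eq_bigr do rewrite dbary_lin_vertex // mulrBr.
rewrite big_split /= sumrN -mulr_suml t1 mul1r [LHS]addrC subrK.
rewrite (bigD1 i) //= eqxx mulr1 big1 ?addr0 // => j /negPf.
by rewrite eq_sym => ->; rewrite mulr0.
Qed.

(** * The two sums as evaluations of cochains *)

(** Coefficients indexed by increasing maps, seen as a cochain of degree k. *)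
Definition on_sets (F : comNzRingType) (n k : nat)
    (w : {ffun 'I_k -> 'I_n.+1} -> F) (A : {set 'I_n.+1}) : F :=
  if #|A| == k then w (incr_of_set k A) else 0.

Lemma sum_incr_maps (V : nmodType) (n k : nat)
    (f : {ffun 'I_k -> 'I_n.+1} -> V) :
  \sum_(s in incr_maps k n) f s =
  \sum_(A : {set 'I_n.+1} | #|A| == k) f (incr_of_set k A).
Proof.
rewrite (reindex_onto (@incr_of_set k n) (@image_set k n)) /= => [|s]; last first.
  by rewrite inE => /increasing_uniq <-.
apply: eq_bigl => A; apply/andP/eqP => [[inc /eqP <-]|/incr_of_setP [-> ->]] //.
by rewrite card_image_set //; apply: increasing_inj; rewrite inE in inc.
Qed.

(** The expression of the coefficient condition is a coefficient of wedge_ones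
    at a set that contains 0. The minus sign arises because 0 precedes p and so
    contributes an inversion. *)
Lemma wedge_ones_setU0 (F : comNzRingType) (n k : nat)
    (w : {ffun 'I_k -> 'I_n.+1} -> F) (A : {set 'I_n.+1}) :
  #|A| = k -> ord0 \notin A ->
  wedge_ones (on_sets w) (ord0 |: A) =
  w (incr_of_set k A) -
  \sum_(p in A) eps1 F p (remove (incr_of_set k A) p) *
                w (replace (incr_of_set k A) p ord0).
Proof.
move=> Ak A0; have [_ imA] := incr_of_setP Ak.
rewrite /wedge_ones big_setU1 //= setU1K // set_sign1_ord0 mul1r.
rewrite {1}/on_sets Ak eqxx -sumrN; congr (_ + _); apply: eq_bigr => p pA.
have p0 : p != ord0 by apply: contraNneq A0 => <-.
have A0p : ord0 \notin A :\ p by rewrite !inE (negPf A0) andbF.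
have cAp : #|A :\ p| = k.-1 by rewrite -Ak (cardsD1 p A) pA.
rewrite setU1D1 // set_sign1U1 // /inv_sign lt0n p0 expr1 mulN1r mulNr.
rewrite /remove /replace imA.
have [_ _ ->] := eps1_set_sign F cAp (negbT (setD11 p A)).
rewrite /on_sets cardsU1 A0p cAp add1n prednK ?eqxx //.
by rewrite -Ak (cardsD1 p A) pA.
Qed.

Lemma wedge_ones_sum (F : comNzRingType) (n : nat) (I : finType) (P : pred I)
    (c : I -> F) (eta : I -> {set 'I_n.+1} -> F) (A : {set 'I_n.+1}) :
  wedge_ones (fun B => \sum_(a | P a) c a * eta a B) A =
  \sum_(a | P a) c a * wedge_ones (eta a) A.
Proof.
rewrite /wedge_ones; under eq_bigr do rewrite mulr_sumr.
rewrite exchange_big; apply: eq_bigr => a _; rewrite mulr_sumr.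
by apply: eq_bigr => p _; rewrite mulrCA.
Qed.

Lemma contract_hodge_degree (F : comNzRingType) (n k : nat) (lam : 'I_n.+1 -> F)
    (eta : {set 'I_n.+1} -> F) (A : {set 'I_n.+1}) :
  (forall B : {set 'I_n.+1}, #|B| != k -> eta B = 0) -> (k <= n)%N ->
  #|A| != (n - k)%N -> contract lam (hodge lam eta) A = 0.
Proof.
move=> deg hk An; rewrite contract_hodge /hodge.
suff -> : wedge_ones eta (~: A) = 0 by rewrite !mulr0.
apply: big1 => p pA; rewrite deg ?mulr0 //; apply: contraNneq An => E.
have := cardsC A; rewrite (cardsD1 p (~: A)) pA E card_ord add1n addnS.
by case=> /(congr1 (subn^~ k)); rewrite addnK => ->.
Qed.

Definition bary_jacobian (R : realType) (m n k : nat) (v : 'I_n.+1 -> 'rV[R]_m)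
    (u : 'I_k -> 'rV[R]_m) : 'M[R[i]]_(n.+1, k) :=
  \matrix_(i, j) (dbary_lin v i (u j))%:C.

Lemma bary_jacobian_colsum (R : realType) (m n k : nat)
    (v : 'I_n.+1 -> 'rV[R]_m) (u : 'I_k -> 'rV[R]_m) (j : 'I_k) :
  \sum_i bary_jacobian v u i j = 0.
Proof.
under eq_bigr do rewrite mxE.
by rewrite -rmorph_sum /= sum_dbary_lin.
Qed.

(** Hence every frame is attained on tangent vectors. *)
Lemma bary_jacobian_frame (R : realType) (m n k : nat)
    (v : 'I_n.+1 -> 'rV[R]_m) (A : {set 'I_n.+1}) : affinely_independent v ->
  bary_jacobian v (fun j => v (incr_of_set k A j) - v ord0) = frame R[i] k A.
Proof.
move=> hv; apply/matrixP => i j; rewrite !mxE dbary_lin_vertex //.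
by rewrite rmorphB !rmorph_nat.
Qed.

Lemma edge_tangent (R : realType) (m n : nat) (v : 'I_n.+1 -> 'rV[R]_m)
    (a : 'I_n.+1) : v a - v ord0 \in tangent_space v.
Proof.
case: (unliftP ord0 a) => [j|] ->; last by rewrite subrr mem0v.
apply: memv_span; have := mem_tnth j (edges v).
by rewrite tnth_mktuple.
Qed.

Lemma dbary_wedgeE (R : realType) (m n k : nat) (v : 'I_n.+1 -> 'rV[R]_m)
    (A : {set 'I_n.+1}) (x : 'rV[R]_m) (u : 'I_k -> 'rV[R]_m) :
  dbary_wedge v (incr_of_set k A) x u = minor (bary_jacobian v u) A.
Proof.
rewrite /dbary_wedge wedges_det; congr (\det _).
by apply/matrixP => i j; rewrite !mxE dbaryE.
Qed.

Lemma sum_kformE (R : realType) (m k : nat) (I : finType) (P : pred I)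
    (w : I -> kform R m k) (x : 'rV[R]_m) (u : 'I_k -> 'rV[R]_m) :
  (\sum_(i | P i) w i) x u = \sum_(i | P i) w i x u.
Proof. exact: (big_morph (fun f : kform R m k => f x u)). Qed.

(** A Whitney form is the evaluation of the contraction of e_C by the
    barycentric coordinates. *)
Lemma whitneyE (R : realType) (m n l : nat) (v : 'I_n.+1 -> 'rV[R]_m)
    (C : {set 'I_n.+1}) (x : 'rV[R]_m) (u : 'I_l -> 'rV[R]_m) :
  #|C| = l.+1 ->
  whitney v (incr_of_set l.+1 C) x u =
  \sum_(p in C) set_sign1 R[i] p (C :\ p) * baryC v p x *
    minor (bary_jacobian v u) (C :\ p).
Proof.
move=> Cl; have [_ imC] := incr_of_setP Cl.
rewrite /whitney sum_kformE imC; apply: eq_bigr => p pC.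
have cCp : #|C :\ p| = l by move: Cl; rewrite (cardsD1 p C) pC => -[].
rewrite /fscale /remove imC /= dbary_wedgeE.
by have [_ _ ->] := eps1_set_sign R[i] cCp (negbT (setD11 p C)).
Qed.

(** The cochain of coefficients at the point x of the first sum. *)
Definition bernstein_cochain (R : realType) (m n r k : nat)
    (v : 'I_n.+1 -> 'rV[R]_m)
    (omega : {ffun 'I_n.+1 -> 'I_r.+1} -> {ffun 'I_k -> 'I_n.+1} -> R[i])
    (x : 'rV[R]_m) (A : {set 'I_n.+1}) : R[i] :=
  \sum_(a in multi_indices r n) bary_monomial v a x * on_sets (omega a) A.

Lemma bernstein_cochain_degree (R : realType) (m n r k : nat)
    (v : 'I_n.+1 -> 'rV[R]_m)
    (omega : {ffun 'I_n.+1 -> 'I_r.+1} -> {ffun 'I_k -> 'I_n.+1} -> R[i])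
    (x : 'rV[R]_m) (A : {set 'I_n.+1}) :
  #|A| != k -> bernstein_cochain v omega x A = 0.
Proof.
by move=> /negPf Ak; apply: big1 => a _; rewrite /on_sets Ak mulr0.
Qed.

Lemma first_sumE (R : realType) (m n r k : nat)
    (v : 'I_n.+1 -> 'rV[R]_m)
    (omega : {ffun 'I_n.+1 -> 'I_r.+1} -> {ffun 'I_k -> 'I_n.+1} -> R[i])
    (x : 'rV[R]_m) (u : 'I_k -> 'rV[R]_m) :
  (\sum_(a in multi_indices r n) \sum_(s in incr_maps k n)
      fscale (fun x => omega a s * bary_monomial v a x) (dbary_wedge v s)) x u =
  eval_minors (bary_jacobian v u) (bernstein_cochain v omega x).
Proof.
rewrite sum_kformE /eval_minors.
under [RHS]eq_bigr do rewrite mulr_suml.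
rewrite [RHS]exchange_big; apply: eq_bigr => a _; rewrite sum_kformE.
rewrite sum_incr_maps; apply: eq_bigr => A Ak.
by rewrite /fscale dbary_wedgeE /on_sets Ak; congr (_ * _); rewrite mulrC.
Qed.

(** The sum is first collected over sets A of size k. Its inner sum runs over
    the pairs of the set C = ~: A and an element p of C, and the contraction
    runs over the pairs of C :\ p and p. *)
Lemma second_sumE (R : realType) (m n r k : nat)
    (v : 'I_n.+1 -> 'rV[R]_m)
    (omega : {ffun 'I_n.+1 -> 'I_r.+1} -> {ffun 'I_k -> 'I_n.+1} -> R[i])
    (x : 'rV[R]_m) (u : 'I_(n - k) -> 'rV[R]_m) : (k <= n)%N ->
  (\sum_(a in multi_indices r n) \sum_(s in incr_maps k n)
      fscale (fun x => eps _ s (compl s) * omega a s *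
                       (bary_monomial v a x * bary_prod v s x))
             (whitney v (compl s))) x u =
  eval_minors (bary_jacobian v u)
    (contract (fun i => baryC v i x)
      (hodge (fun i => baryC v i x) (bernstein_cochain v omega x))).
Proof.
move=> hk; set lam := fun i => baryC v i x; set M := bary_jacobian v u.
set Om := bernstein_cochain v omega x.
have cC (A : {set 'I_n.+1}) : #|A| = k -> #|~: A| = (n - k).+1.
  by move=> Ak; have := cardsC A; rewrite card_ord Ak => /(canRL (addKn _)) ->;
    rewrite subSn.
transitivity (\sum_(A : {set 'I_n.+1} | #|A| == k)
    set_sign R[i] A (~: A) * (\prod_(i in A) lam i) * Om A *
    \sum_(p in ~: A) set_sign1 R[i] p (~: A :\ p) * lam p * minor M (~: A :\ p)).
  rewrite sum_kformE /Om /bernstein_cochain.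
  under [RHS]eq_bigr do rewrite [X in X * _]mulr_sumr mulr_suml.
  rewrite [RHS]exchange_big; apply: eq_bigr => a _; rewrite sum_kformE.
  rewrite sum_incr_maps; apply: eq_bigr => A /eqP Ak.
  have [incA imA] := incr_of_setP Ak; rewrite inE in incA.
  have [incC imC] := incr_of_setP (cC A Ak); rewrite inE in incC.
  rewrite /fscale /compl imA whitneyE ?cC //.
  have [|_ ->] := eps_set_sign R[i] incA incC.
    by rewrite imA imC -setI_eq0 setICr.
  rewrite imA imC /bary_prod -(big_image_set _ lam (increasing_inj incA)) imA.
  rewrite /on_sets Ak eqxx; congr (_ * _); ring.
rewrite /eval_minors [RHS]big_mkcond /=.
pose f p (C : {set 'I_n.+1}) : R[i] := if #|C :\ p| == (n - k)%N then
  set_sign1 R[i] p (C :\ p) * lam p * hodge lam Om C * minor M (C :\ p) else 0.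
transitivity (\sum_(C : {set 'I_n.+1}) \sum_(p in C) f p C); last first.
  rewrite big_pair_remove_add; apply: eq_bigr => B _; rewrite /f.
  case: ifPn => [/eqP|/negPf] Bk.
    rewrite /contract mulr_suml; apply: eq_bigr => p; rewrite inE => pB.
    by rewrite setU1K // Bk eqxx.
  by apply: big1 => p; rewrite inE => pB; rewrite setU1K // Bk.
rewrite [RHS](reindex_inj (@setC_inj _)) big_mkcond /=; apply: eq_bigr => A _.
case: ifPn => [/eqP|] Ak; last first.
  apply/esym/big1 => p _; rewrite /f /hodge setCK /Om.
  by rewrite bernstein_cochain_degree // !mulr0 mul0r if_same.
rewrite mulr_sumr; apply: eq_bigr => p pA; rewrite /f /hodge setCK.
have -> : #|~: A :\ p| = (n - k)%N.
  by have := cC A Ak; rewrite (cardsD1 p) pA => -[].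
by rewrite eqxx; ring.
Qed.

(** * The equivalences *)

Lemma coefficient_conditionP (R : realType) (n r k : nat)
    (omega : {ffun 'I_n.+1 -> 'I_r.+1} -> {ffun 'I_k -> 'I_n.+1} -> R[i]) :
  (forall (a : {ffun 'I_n.+1 -> 'I_r.+1}) (s : {ffun 'I_k -> 'I_n.+1}),
      a \in multi_indices r n -> s \in incr_maps k n ->
      ord0 \notin image_set s ->
      omega a s - \sum_(p in image_set s)
        eps1 _ p (remove s p) * omega a (replace s p ord0) = 0) <->
  (forall (a : {ffun 'I_n.+1 -> 'I_r.+1}) (A : {set 'I_n.+1}),
      a \in multi_indices r n -> wedge_ones (on_sets (omega a)) A = 0).
Proof.
split=> [H a A am|H a s am sm s0].
  apply: wedge_ones_eq0 => {}A A0; have [Ak|Ak] := eqVneq #|A| k.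
    have [incA imA] := incr_of_setP Ak.
    rewrite wedge_ones_setU0 //; move: (H a (incr_of_set k A) am incA).
    by rewrite imA => ->.
  rewrite /wedge_ones big1 // => p pA; rewrite /on_sets.
  have := cardsD1 p (ord0 |: A); rewrite pA cardsU1 A0 => /eqP.
  by rewrite eqn_add2l => /eqP <-; rewrite (negPf Ak) mulr0.
have incs : increasing s by rewrite inE in sm.
have ck := card_image_set (increasing_inj incs).
have := H a (ord0 |: image_set s) am.
by rewrite wedge_ones_setU0 // -(increasing_uniq incs).
Qed.

Theorem theorem5p2 (R : realType) (m n r : nat) (v : 'I_n.+1 -> 'rV[R]_m)
    (hv : affinely_independent v) (k : nat) (hk : (k <= n)%N)
    (omega : {ffun 'I_n.+1 -> 'I_r.+1} -> {ffun 'I_k -> 'I_n.+1} -> R[i]) :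
  let first_sum : kform R m k :=
    \sum_(a in multi_indices r n) \sum_(s in incr_maps k n)
      fscale (fun x => omega a s * bary_monomial v a x) (dbary_wedge v s) in
  let second_sum : kform R m (n - k) :=
    \sum_(a in multi_indices r n) \sum_(s in incr_maps k n)
      fscale (fun x => eps _ s (compl s) * omega a s *
                       (bary_monomial v a x * bary_prod v s x))
             (whitney v (compl s)) in
  let coefficient_condition : Prop :=
    forall (a : {ffun 'I_n.+1 -> 'I_r.+1}) (s : {ffun 'I_k -> 'I_n.+1}),
      a \in multi_indices r n -> s \in incr_maps k n ->
      ord0 \notin image_set s ->
      omega a s - \sum_(p in image_set s)
        eps1 _ p (remove s p) * omega a (replace s p ord0) = 0 in
  [/\ vanishes_on_simplex v first_sum <-> vanishes_on_simplex v second_sum,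
      vanishes_on_simplex v first_sum <-> coefficient_condition
    & vanishes_on_simplex v second_sum <-> coefficient_condition].
Proof.
move=> first_sum second_sum coefficient_condition.
pose Om := bernstein_cochain v omega.
have cond_cocycle : coefficient_condition -> forall x A, wedge_ones (Om x) A = 0.
  move=> /coefficient_conditionP H x A.
  rewrite /Om wedge_ones_sum; apply: big1 => a am; rewrite H ?mulr0 //.
have interior_cond : (forall t : 'I_n.+1 -> R, (forall i, 0 < t i) ->
      \sum_i t i = 1 -> forall A, wedge_ones (Om (\sum_i t i *: v i)) A = 0) ->
    coefficient_condition.
  move=> H; apply/coefficient_conditionP => a A am.
  apply: (@monomials_independent R r n
    (fun b => wedge_ones (on_sets (omega b)) A)) am => t t0 t1.
  rewrite -[RHS](H t t0 t1 A) /Om wedge_ones_sum; apply: eq_bigr => b _.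
  rewrite mulrC /bary_monomial; congr (_ * _); apply: eq_bigr => i _.
  by rewrite /baryC bary_combination.
have interior_in t : (forall i, 0 < t i) -> \sum_i t i = 1 ->
    in_simplex v (\sum_i t i *: v i).
  by move=> t0 t1; exists t; split=> // i; exact: ltW.
have frame_tangent l (A : {set 'I_n.+1}) (j : 'I_l) :
    v (incr_of_set l A j) - v ord0 \in tangent_space v.
  exact: edge_tangent.
have firstP : vanishes_on_simplex v first_sum <-> coefficient_condition.
  split=> [H|H x u _ _].
    apply: interior_cond => t t0 t1; set x := \sum_i _.
    apply: (@wedge_ones_eval _ n k) => A.
      exact: bernstein_cochain_degree.
    move=> Ak A0; rewrite -(bary_jacobian_frame k A hv) -first_sumE.
    by apply: H => //; exact: interior_in.
  rewrite /first_sum first_sumE eval_minors_eq0 //.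
    exact: bary_jacobian_colsum.
  exact: cond_cocycle.
have secondP : vanishes_on_simplex v second_sum <-> coefficient_condition.
  split=> [H|H x u _ _].
    apply: interior_cond => t t0 t1; set x := \sum_i _.
    apply: (@wedge_ones_contract_hodge _ n (fun i => baryC v i x)).
    - by rewrite -rmorph_sum /= sum_bary.
    - move=> i; rewrite /baryC bary_combination //.
      by rewrite (inj_eq (@complexI R)) gt_eqF.
    apply: (@wedge_ones_eval _ n (n - k)) => A.
      apply: contract_hodge_degree hk; exact: bernstein_cochain_degree.
    move=> Ak A0; rewrite -(bary_jacobian_frame (n - k) A hv) -second_sumE //.
    by apply: H => //; exact: interior_in.
  rewrite /second_sum second_sumE //.
  apply: big1 => A _.
  by rewrite contract_hodge_eq0 ?mul0r //; exact: cond_cocycle.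
by split=> //; rewrite firstP secondP.
Qed.
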